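(* Let $\mathcal{H}$ be a separable Hilbert space and let $f:\mathcal{H}\to\mathcal{H}$ satisfy $\langle f(x)-f(y),x-y\rangle\ge 0$ for all $x,y\in\mathcal{H}$. Suppose that for some $x_0\in\mathcal{H}$, $r\ge 2$ and $R>0$ one has $\sup_{x\in B_r(x_0)}|f(x)|\le R$. Define $t,s:\mathcal{H}\to\mathbb{R}$ by $$t(x)=\begin{cases}1,& |x-x_0|\le r-1,\\ r-|x-x_0|,& r-1<|x-x_0|<r,\\ 0,& |x-x_0|\ge r,\end{cases}\qquad s(x)=\begin{cases}0,&|x-x_0|\le r-2,\\ |x-x_0|-r+2,& r-2<|x-x_0|<r-1,\\ 1,& r-1\le|x-x_0|\le r,\\ \frac{r}{|x-x_0|},&|x-x_0|\ge r.\end{cases}$$ Then the function $\tilde f_{R,r,x_0}:\mathcal{H}\to\mathcal{H}$ given by $$\tilde f_{R,r,x_0}(x):=t(x)f(x)+R\,s(x)(x-x_0)$$ has the following properties: (i) $\tilde f_{R,r,x_0}(x)=f(x)$ for every $x\in B_{r-2}(x_0)$. (ii) $|\tilde f_{R,r,x_0}(x)|\le R\,(1+\min\{r,|x-x_0|\})$ for every $x\in\mathcal{H}$. (iii) If $f$ is Lipschitz on $B_r(x_0)$, then $\tilde f_{R,r,x_0}$ is globally Lipschitz and $Lip(\tilde f_{R,r,x_0})\le Lip_{B_r(x_0)}(f)+Rr$. (iv) $\langle \tilde f_{R,r,x_0}(x)-\tilde f_{R,r,x_0}(y),x-y\rangle\ge 0$ for all $x,y\in\mathcal{H}$.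
   Context: $\mathcal{H}$ is a separable (finite or infinite dimensional) Hilbert space with inner product $\langle\cdot,\cdot\rangle$ and norm $|\cdot|$. $B_r(x)$ denotes the open ball of radius $r$ around $x$ (so $B_0(x)=\emptyset$). For $A\subset\mathcal{H}$, $Lip_A(f):=\sup_{x,y\in A,\,x\ne y}\frac{|f(x)-f(y)|}{|x-y|}$; $f$ is called Lipschitz on $A$ if $Lip_A(f)<\infty$, and $Lip(f):=Lip_{\mathcal{H}}(f)$ is the global Lipschitz constant. *)

(* Defs.v *)
From mathcomp Require Import all_boot all_order all_algebra.
From mathcomp Require Import all_classical all_reals all_analysis.
Set Implicit Arguments.
Unset Strict Implicit.
Unset Printing Implicit Defensive.
Import Order.TTheory GRing.Theory Num.Theory.
Import numFieldNormedType.Exports.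
Local Open Scope classical_set_scope.
Local Open Scope ring_scope.

Definition separable (T : topologicalType) : Prop :=
  exists2 S : set T, countable S & dense S.

(* A positive definite symmetric bilinear form whose norm is the norm of [H].
   Together with the completeness of [H], this makes [H] a real Hilbert
   space. *)
Definition is_inner_product (K : realType) (H : normedModType K)
    (dot : {dot H for (@idfun K)}) : Prop :=
  forall x : H, `|x| = Num.sqrt (dot x x).

(* The supremum is taken in [0, +oo]: adding the value 0 to the nonnegative
   difference quotients only matters when [A] has at most one point, where it
   makes the supremum 0 instead of -oo. *)
Definition LipOn (K : realType) (H : normedModType K) (A : set H)
    (f : H -> H) : \bar K :=
  ereal_sup (0%E |` [set q : \bar K | exists x y : H,
    [/\ A x, A y, x != y & q = (`|f x - f y| / `|x - y|)%:E]]).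

Definition Lip (K : realType) (H : normedModType K) (f : H -> H) : \bar K :=
  LipOn setT f.

Definition cutoff_t (K : realType) (H : normedModType K) (r : K) (x0 x : H)
    : K :=
  if `|x - x0| <= r - 1 then 1
  else if `|x - x0| < r then r - `|x - x0|
  else 0.

Definition cutoff_s (K : realType) (H : normedModType K) (r : K) (x0 x : H)
    : K :=
  if `|x - x0| <= r - 2 then 0
  else if `|x - x0| < r - 1 then `|x - x0| - r + 2
  else if `|x - x0| <= r then 1
  else r / `|x - x0|.

Definition ftilde (K : realType) (H : normedModType K) (f : H -> H)
    (R r : K) (x0 x : H) : H :=
  cutoff_t r x0 x *: f x + (R * cutoff_s r x0 x) *: (x - x0).

(* Main.v *)
Require Import Defs.
From mathcomp Require Import all_boot all_order all_algebra.
From mathcomp Require Import all_classical all_reals all_analysis.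
From mathcomp Require Import ring lra.
Set Implicit Arguments.
Unset Strict Implicit.
Unset Printing Implicit Defensive.
Import Order.TTheory GRing.Theory Num.Theory.
Import numFieldNormedType.Exports.
Local Open Scope classical_set_scope.
Local Open Scope ring_scope.

(** With [rho <= sigma] the distances of [x] and [y] to [x0], write
    [t, t'], [s, s'] for the cutoffs at [x] and [y]. Everything rests on
    [ftilde x - ftilde y
      = t' (f x - f y) + (t - t') f x + R (s (x - x0) - s' (y - x0))]
    where [t - t' >= 0] vanishes unless [x] lies in the ball, so that only
    [f x], which is bounded by [R], appears undifferenced. In a Hilbert space
    the last term is controlled by [|x - y|] and the radial increments
    [s' sigma - s rho] and [sigma - rho], and what remains is a
    comparison of one-variable piecewise functions: [rho s + t] is
    nondecreasing, [rho s - t] is [r]-Lipschitz, and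
    [t - t' <= s' (sigma - rho)]. *)

(** * Inner product identities in polar form *)

Section InnerProduct.
Context (K : realType) (H : normedModType K) (dot : {dot H for (@idfun K)}).
Hypothesis dotP : is_inner_product dot.

Lemma inner_sym (u v : H) : dot u v = dot v u.
Proof. by rewrite hermC expr0 mul1r. Qed.

Lemma inner_sqr (u : H) : dot u u = `|u| ^+ 2.
Proof.
rewrite dotP sqr_sqrtr //.
have [->|u0] := eqVneq u 0; first by rewrite linear0l.
exact/ltW/neq0_dnorm_gt0.
Qed.

Lemma innerDl (u v w : H) : dot (u + v) w = dot u w + dot v w.
Proof. exact: linearDl. Qed.

Lemma innerZl (a : K) (u v : H) : dot (a *: u) v = a * dot u v.
Proof. exact: linearZl_LR. Qed.

Lemma innerBr (u v w : H) : dot u (v - w) = dot u v - dot u w.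
Proof. exact: linearBr. Qed.

Lemma inner_scale_sub (a b c d : K) (u v : H) :
  dot (a *: u - b *: v) (c *: u - d *: v) =
  a * c * `|u| ^+ 2 + b * d * `|v| ^+ 2 - (a * d + b * c) * dot u v.
Proof.
have scaler e (w z : H) : dot w (e *: z) = e * dot w z.
  by rewrite inner_sym innerZl inner_sym.
rewrite -scaleNr innerDl !innerZl !innerBr !scaler (inner_sym v u) !inner_sqr.
by ring.
Qed.

Lemma inner_polar (u v : H) :
  dot u v = (`|u| ^+ 2 + `|v| ^+ 2 - `|u - v| ^+ 2) / 2.
Proof.
have := inner_scale_sub 1 1 1 1 u v; rewrite !scale1r inner_sqr => ->.
by field.
Qed.

(** One half of Cauchy-Schwarz: by polarization it is the square of the triangle inequality |u - v|
    <= |u| + |v|. *)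
Lemma inner_ge_opp_norm (u v : H) : - (`|u| * `|v|) <= dot u v.
Proof.
have : `|u - v| ^+ 2 <= (`|u| + `|v|) ^+ 2.
  by rewrite lerXn2r ?nnegrE ?addr_ge0 // ler_normB.
by rewrite inner_polar; lra.
Qed.

(** Splits off the radial part. The other bracket equals 2 (|u| |v| - <u, v>) >= 0, the angular
    part, so its coefficient can be estimated separately; [norm_sqr_radial] is the same splitting of
    a squared norm. *)
Lemma inner_radial (a b : K) (u v : H) :
  dot (a *: u - b *: v) (u - v) =
  (b * `|v| - a * `|u|) * (`|v| - `|u|)
  + (a + b) / 2 * (`|u - v| ^+ 2 - (`|v| - `|u|) ^+ 2).
Proof.
have := inner_scale_sub a b 1 1 u v; rewrite !scale1r => ->.
by rewrite inner_polar; field.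
Qed.

Lemma norm_sqr_radial (a b : K) (u v : H) :
  `|a *: u - b *: v| ^+ 2 =
  (b * `|v| - a * `|u|) ^+ 2
  + a * b * (`|u - v| ^+ 2 - (`|v| - `|u|) ^+ 2).
Proof. by rewrite -[LHS]inner_sqr inner_scale_sub inner_polar; field. Qed.

End InnerProduct.

(** * One-variable comparison of the cutoffs *)

Section Cutoffs.
Context (K : realType) (H : normedModType K) (r : K) (x0 : H).
Local Notation t := (cutoff_t r x0).
Local Notation s := (cutoff_s r x0).

Lemma cutoff_t_itv (x : H) : 0 <= t x <= 1.
Proof.
rewrite /cutoff_t; have [?|?] := leP `|x - x0| (r - 1).
  by rewrite ler01 lexx.
by have [?|?] := ltP `|x - x0| r; apply/andP; split; lra.
Qed.

Lemma cutoff_t_out (x : H) : r <= `|x - x0| -> t x = 0.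
Proof. by move=> rx; rewrite /cutoff_t !ifF //; lra. Qed.

Lemma cutoff_s_itv (r_ge2 : 2 <= r) (x : H) : 0 <= s x <= 1.
Proof.
rewrite /cutoff_s; have [h1|h1] := leP `|x - x0| (r - 2).
  by rewrite lexx ler01.
have [h2|h2] := ltP `|x - x0| (r - 1); first by apply/andP; split; lra.
have [h3|h3] := leP `|x - x0| r; first by rewrite lexx ler01.
have n0 : 0 < `|x - x0| by lra.
by rewrite ler_pdivrMr // mul1r (ltW h3) divr_ge0 //; lra.
Qed.

Lemma cutoff_s_mulE (r_ge2 : 2 <= r) (x : H) :
  r <= `|x - x0| -> s x * `|x - x0| = r.
Proof.
move=> rx; rewrite /cutoff_s ifF; last lra.
rewrite ifF; last lra.
case: leP => [xr|rx']; first by rewrite mul1r; lra.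
by rewrite divfK //; apply/eqP; lra.
Qed.

Lemma cutoff_s_mul_le (r_ge2 : 2 <= r) (x : H) :
  s x * `|x - x0| <= Num.min r `|x - x0|.
Proof.
have /andP[s0 s1] := cutoff_s_itv r_ge2 x; rewrite le_min; apply/andP; split.
  have [/(cutoff_s_mulE r_ge2)-> //|xr] := leP r `|x - x0|.
  by have := normr_ge0 (x - x0); nra.
by rewrite ler_piMl.
Qed.

(* [cutoff_s] without the quotient *)
Lemma cutoffP (r_ge2 : 2 <= r) (x : H) :
  [\/ [/\ `|x - x0| <= r - 2, t x = 1 & s x = 0],
      [/\ r - 2 <= `|x - x0| <= r - 1, t x = 1 & s x = `|x - x0| - r + 2],
      [/\ r - 1 <= `|x - x0| <= r, t x = r - `|x - x0| & s x = 1] |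
      [/\ r <= `|x - x0|, t x = 0 & s x * `|x - x0| = r]].
Proof.
have sE := cutoff_s_mulE r_ge2 (x := x); have tE := @cutoff_t_out x.
move: sE tE; rewrite /cutoff_t /cutoff_s; set n := `|x - x0|.
have [h1|h1] := leP n (r - 2).
  by rewrite ifT; [constructor 1|lra].
have [h2|h2] := ltP n (r - 1).
  by rewrite ifT; [constructor 2; split => //; apply/andP; split; lra|lra].
have [h3|h3] := leP n r => sE tE; last first.
  by constructor 4; split; [|apply: tE|apply: sE]; exact: ltW.
constructor 3; split => //.
(* Both endpoints belong to this case; there the neighbouring values 1 and 0 of [t] agree with r -
   n. *)
have [h4|h4] := leP n (r - 1); first lra.
by case: ltP => ?; lra.
Qed.

Lemma cutoff_t_anti (r_ge2 : 2 <= r) (x y : H)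
    (le_xy : `|x - x0| <= `|y - x0|) : t y <= t x.
Proof.
case: (cutoffP r_ge2 x) => [] [/= hx tx sx];
  case: (cutoffP r_ge2 y) => [] [/= hy ty sy];
  rewrite tx ty; lra.
Qed.

(** While [t] falls, [s] is 1 and the two slopes cancel: rho + (r - rho) = r. Elsewhere [t] is
    constant and rho s does not decrease. *)
Lemma cutoff_radial_mono (r_ge2 : 2 <= r) (x y : H)
    (le_xy : `|x - x0| <= `|y - x0|) :
  s x * `|x - x0| + t x <= s y * `|y - x0| + t y.
Proof.
have n0 := normr_ge0 (x - x0).
by case: (cutoffP r_ge2 x) => [] [/= hx tx sx];
  case: (cutoffP r_ge2 y) => [] [/= hy ty sy];
  rewrite tx ty ?sx ?sy; nra.
Qed.

(** A drop of [t] forces |y - x0| > r - 1. If |y - x0| <= r, then [s y] is 1 and [t] is 1-Lipschitz.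
    Beyond, for |x - x0| <= r, the right side is r - r |x - x0| / |y - x0| >= r - |x - x0| >=
    [t x]. *)
Lemma cutoff_t_sub_le (r_ge2 : 2 <= r) (x y : H)
    (le_xy : `|x - x0| <= `|y - x0|) :
  t x - t y <= s y * (`|y - x0| - `|x - x0|).
Proof.
have n0 := normr_ge0 (x - x0); have /andP[sy0 sy1] := cutoff_s_itv r_ge2 y.
by case: (cutoffP r_ge2 x) => [] [/= hx tx sx];
  case: (cutoffP r_ge2 y) => [] [/= hy ty sy];
  rewrite tx ty ?mulrBr ?sx ?sy; nra.
Qed.

(** The slopes of rho s - t on the four pieces are 0, 2 rho - r + 2 (at most r, since rho <= r - 1),
    2 and 0; the third is where r >= 2 matters. *)
Lemma cutoff_radial_lip (r_ge2 : 2 <= r) (x y : H)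
    (le_xy : `|x - x0| <= `|y - x0|) :
  (t x - t y) + (s y * `|y - x0| - s x * `|x - x0|)
    <= r * (`|y - x0| - `|x - x0|).
Proof.
have n0 := normr_ge0 (x - x0).
by case: (cutoffP r_ge2 x) => [] [/= hx tx sx];
  case: (cutoffP r_ge2 y) => [] [/= hy ty sy];
  rewrite tx ty ?sx ?sy; nra.
Qed.

End Cutoffs.

(** * Growth, Lipschitz constant and monotonicity of the truncated map *)

Section Truncation.
Context (K : realType) (H : normedModType K) (f : H -> H) (x0 : H) (r R : K).
Local Notation t := (cutoff_t r x0).
Local Notation s := (cutoff_s r x0).
Local Notation F := (ftilde f R r x0).

Lemma ftilde_sub (x y : H) :
  F x - F y = t y *: (f x - f y) + (t x - t y) *: f x
              + R *: (s x *: (x - x0) - s y *: (y - x0)).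
Proof.
rewrite /ftilde !scalerBr !scalerA scalerBl (addrC (_ - t y *: f y)).
by rewrite [X in _ = X + _]addrA subrK opprD addrACA.
Qed.

Lemma cutoff_t_scale_norm_le (r_ge2 : 2 <= r)
    (f_bnd : forall x, `|x - x0| < r -> `|f x| <= R) (x y : H) :
  `|x - x0| <= `|y - x0| ->
  `|(t x - t y) *: f x| <= (t x - t y) * R.
Proof.
move=> xy; have txy := cutoff_t_anti r_ge2 xy.
have [rx|/f_bnd fx] := leP r `|x - x0|.
  by rewrite !cutoff_t_out ?(le_trans rx) // subrr scale0r normr0 mul0r.
by rewrite normrZ ger0_norm ?subr_ge0 // ler_wpM2l // subr_ge0.
Qed.

Lemma ftilde_norm_le (r_ge2 : 2 <= r) (R_ge0 : 0 <= R)
    (f_bnd : forall x, `|x - x0| < r -> `|f x| <= R) (x : H) :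
  `|F x| <= R * (1 + Num.min r `|x - x0|).
Proof.
have /andP[t0 t1] := cutoff_t_itv r x0 x.
have /andP[s0 s1] := cutoff_s_itv x0 r_ge2 x.
rewrite (le_trans (ler_normD _ _)) // mulrDr mulr1 lerD //.
  have [rx|/f_bnd fx] := leP r `|x - x0|.
    by rewrite cutoff_t_out // scale0r normr0.
  by rewrite normrZ ger0_norm // (le_trans _ fx) // ler_piMl.
rewrite normrZ ger0_norm ?mulr_ge0 // -mulrA ler_wpM2l //.
exact: cutoff_s_mul_le.
Qed.

Context (dot : {dot H for (@idfun K)}).
Hypothesis dotP : is_inner_product dot.

(** Multiplied by R, this bounds the last two terms of [ftilde_sub] jointly; estimating them one by
    one would give a constant larger than R r. *)
Lemma cutoff_radial_norm_le (r_ge2 : 2 <= r) (x y : H) :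
  `|x - x0| <= `|y - x0| ->
  (t x - t y) + `|s x *: (x - x0) - s y *: (y - x0)| <= r * `|x - y|.
Proof.
move=> xy.
have txy := cutoff_t_anti r_ge2 xy.
have C := cutoff_radial_mono r_ge2 xy.
have D := cutoff_t_sub_le r_ge2 xy.
have E := cutoff_radial_lip r_ge2 xy.
have /andP[sx0 sx1] := cutoff_s_itv x0 r_ge2 x.
have /andP[sy0 sy1] := cutoff_s_itv x0 r_ge2 y.
have dD : `|y - x0| - `|x - x0| <= `|x - y|.
  by rewrite (le_trans (lerB_dist _ _)) // opprB addrA subrK distrC.
have := norm_sqr_radial dotP (s x) (s y) (x - x0) (y - x0).
have -> : x - x0 - (y - x0) = x - y by rewrite opprB addrA subrK.
set N := `|_ - _ *: _|; have N0 : 0 <= N by exact: normr_ge0.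
move: N N0 xy txy C D E dD sx0 sx1 sy0 sy1.
(* Only an inequality between real numbers is left. *)
move: (t x) (t y) (s x) (s y) `|x - x0| `|y - x0| `|x - y|.
move=> tx ty sx sy rho sigma d N N0 xy txy C D E dD sx0 sx1 sy0 sy1.
set a := tx - ty; set b := sy * sigma - sx * rho => NE.
have a0 : 0 <= a by rewrite /a; lra.
have ab : a <= b by rewrite /a /b; lra.
have abr : a + b <= r * (sigma - rho) by [].
have ad : a <= sigma - rho by rewrite /a; nra.
have q1 : sx * sy <= 1 by nra.
have q0 : 0 <= sx * sy by nra.
move: NE abr ad dD; set e := sigma - rho => NE abr ad ed.
have e0 : 0 <= e by lra.
have ra0 : 0 <= r * d - a by nra.
(* Compare squares: the radial part b^2 is at most (r e - a)^2, and the angular part has coefficient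
   s s' <= 1. *)
rewrite -lerBrDl -(ler_sqr N0 ra0) NE.
have h1 : b ^+ 2 <= (r * e - a) ^+ 2.
  by rewrite ler_sqr ?nnegrE; lra.
have h2 : sx * sy * (d ^+ 2 - e ^+ 2) <= d ^+ 2 - e ^+ 2.
  by rewrite ler_piMl // subr_ge0 ler_sqr // nnegrE; lra.
(* [(r d - a)^2 - (r e - a)^2 - (d^2 - e^2)], factored *)
have h3 : 0 <= (d - e) * (r * (r * (d + e) - 2 * a) - (d + e)).
  apply: mulr_ge0; first lra.
  (* From a <= e <= d; the second factor is then at least (r (r - 1) - 1) (d + e), nonnegative as r
     >= 2. *)
  have : 2 * a <= d + e by lra.
  by nra.
by nra.
Qed.

Lemma ftilde_lip_ordered (r_ge2 : 2 <= r) (R_ge0 : 0 <= R)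
    (f_bnd : forall x, `|x - x0| < r -> `|f x| <= R) (L : K) (L_ge0 : 0 <= L)
    (f_lip : forall x y, `|x - x0| < r -> `|y - x0| < r ->
      `|f x - f y| <= L * `|x - y|) (x y : H) :
  `|x - x0| <= `|y - x0| -> `|F x - F y| <= (L + R * r) * `|x - y|.
Proof.
move=> xy; have /andP[ty0 ty1] := cutoff_t_itv r x0 y.
have h1 : `|t y *: (f x - f y)| <= L * `|x - y|.
  (* If the farther point [y] is in the ball, so is [x]; otherwise the term vanishes. *)
  have [ry|yr] := leP r `|y - x0|.
    by rewrite cutoff_t_out // scale0r normr0 mulr_ge0.
  rewrite normrZ ger0_norm // (le_trans (ler_piMl _ ty1)) //.
  by apply: f_lip => //; exact: le_lt_trans yr.
have h2 := cutoff_t_scale_norm_le r_ge2 f_bnd xy.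
have h3 := cutoff_radial_norm_le r_ge2 xy.
rewrite ftilde_sub (le_trans (ler_normD _ _)) //.
rewrite (le_trans (lerD (le_trans (ler_normD _ _) (lerD h1 h2)) (lexx _))) //.
rewrite normrZ ger0_norm // [leRHS]mulrDl -addrA lerD // -mulrA [_ * R]mulrC.
by rewrite -mulrDr ler_wpM2l.
Qed.

Lemma ftilde_mono_ordered (r_ge2 : 2 <= r) (R_ge0 : 0 <= R)
    (f_bnd : forall x, `|x - x0| < r -> `|f x| <= R)
    (f_mono : forall x y, 0 <= dot (f x - f y) (x - y)) (x y : H) :
  `|x - x0| <= `|y - x0| -> 0 <= dot (F x - F y) (x - y).
Proof.
move=> xy; have /andP[ty0 ty1] := cutoff_t_itv r x0 y.
have txy := cutoff_t_anti r_ge2 xy.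
have h2 := cutoff_t_scale_norm_le r_ge2 f_bnd xy.
have CS := inner_ge_opp_norm dotP ((t x - t y) *: f x) (x - y).
rewrite ftilde_sub !innerDl !innerZl -addrA addr_ge0 ?mulr_ge0 //.
rewrite innerZl in CS.
have {CS}h4 : - ((t x - t y) * R * `|x - y|) <= (t x - t y) * dot (f x) (x - y).
  by apply: le_trans CS; rewrite lerN2 ler_wpM2r.
(* The first term is nonnegative by monotonicity of [f], so the radial term only has to absorb the
   Cauchy-Schwarz loss (t - t') R |x - y|. *)
suff h5 : (t x - t y) * `|x - y|
    <= dot (s x *: (x - x0) - s y *: (y - x0)) (x - y).
  by have := ler_wpM2l R_ge0 h5; lra.
have C := cutoff_radial_mono r_ge2 xy.
have D := cutoff_t_sub_le r_ge2 xy.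
have /andP[sx0 sx1] := cutoff_s_itv x0 r_ge2 x.
have /andP[sy0 sy1] := cutoff_s_itv x0 r_ge2 y.
have dD : `|y - x0| - `|x - x0| <= `|x - y|.
  by rewrite (le_trans (lerB_dist _ _)) // opprB addrA subrK distrC.
have := inner_radial dotP (s x) (s y) (x - x0) (y - x0).
have -> : x - x0 - (y - x0) = x - y by rewrite opprB addrA subrK.
move=> ->; clear h2 h4 ty0 ty1.
move: xy txy C D dD sx0 sx1 sy0 sy1.
move: (t x) (t y) (s x) (s y) `|x - x0| `|y - x0| `|x - y|.
move=> tx ty sx sy rho sigma d xy txy C D dD sx0 sx1 sy0 sy1.
set a := tx - ty; set b := sy * sigma - sx * rho.
have ab : a <= b by rewrite /a /b; lra.
have a0 : 0 <= a by rewrite /a; lra.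
move: D dD; rewrite -/a; set e := sigma - rho => D ed.
have e0 : 0 <= e by rewrite /e; lra.
have h1 : a * e <= b * e by rewrite ler_wpM2r.
(* Write a d = a e + a (d - e): b e pays for the first part, the angular term for the second,
   because a <= s' e and 2 e <= d + e. *)
have h2 : 0 <= (d - e) * ((sx + sy) / 2 * (d + e) - a).
  by apply: mulr_ge0; [lra|nra].
by nra.
Qed.

End Truncation.

(** * Extended-real Lipschitz constants and pointwise bounds *)

Lemma LipOn_lt_pinftyP (K : realType) (H : normedModType K) (A : set H)
    (g : H -> H) : (LipOn A g < +oo)%E ->
  exists2 L : K, 0 <= L & LipOn A g = L%:E /\
    forall x y, A x -> A y -> `|g x - g y| <= L * `|x - y|.
Proof.
have ub := @ereal_sup_ubound K (0%E |` [set q : \bar K | exists x y : H,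
    [/\ A x, A y, x != y & q = (`|g x - g y| / `|x - y|)%:E]]).
rewrite -/(LipOn A g) in ub.
(* The value 0 in the supremum excludes -oo and gives [0 <= L], even for empty [A]. *)
have := ub 0%E (or_introl erefl).
case: (LipOn A g) ub => [L| |] //= ub; rewrite lee_fin => L0 _.
exists L => //; split=> // x y Ax Ay.
have [->|xy] := eqVneq x y; first by rewrite !subrr normr0 mulr0.
rewrite -ler_pdivrMr ?normr_gt0 ?subr_eq0 // -lee_fin.
by apply: ub; right; exists x, y.
Qed.

Lemma Lip_le (K : realType) (H : normedModType K) (g : H -> H) (L : K) :
  0 <= L -> (forall x y, `|g x - g y| <= L * `|x - y|) -> (Lip g <= L%:E)%E.
Proof.
move=> L0 gL; apply: ge_ereal_sup => _ [->|[x [y [_ _ xy ->]]]].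
  by rewrite lee_fin.
by rewrite lee_fin ler_pdivrMr ?normr_gt0 ?subr_eq0.
Qed.

Theorem theorem2p1 (K : realType) (H : completeNormedModType K)
    (dot : {dot H for (@idfun K)}) (dotP : is_inner_product dot)
    (sepH : separable H)
    (f : H -> H)
    (f_mono : forall x y : H, 0 <= dot (f x - f y) (x - y))
    (x0 : H) (r R : K) (r_ge2 : 2 <= r) (R_gt0 : 0 < R)
    (f_bnd : (ereal_sup [set `|f x|%:E | x in ball x0 r] <= R%:E)%E) :
  [/\ (* (i) *)
      forall x : H, ball x0 (r - 2) x -> ftilde f R r x0 x = f x,
      (* (ii) *)
      forall x : H, `|ftilde f R r x0 x| <= R * (1 + Num.min r `|x - x0|),
      (* (iii) *)
      (LipOn (ball x0 r) f < +oo)%E ->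
        (Lip (ftilde f R r x0) < +oo)%E /\
        (Lip (ftilde f R r x0) <= LipOn (ball x0 r) f + (R * r)%:E)%E
    & (* (iv) *)
      forall x y : H,
        0 <= dot (ftilde f R r x0 x - ftilde f R r x0 y) (x - y)].
Proof.
have ballE c x : ball x0 c x = (`|x - x0| < c) :> Prop.
  by rewrite -ball_normE /= distrC.
have R_ge0 := ltW R_gt0.
have f_le x : `|x - x0| < r -> `|f x| <= R.
  move=> xr; rewrite -lee_fin; apply: le_trans f_bnd.
  by apply: ereal_sup_ubound; exists x => //=; rewrite ballE.
split.
- move=> x; rewrite ballE => xr.
  rewrite /ftilde /cutoff_t /cutoff_s !ifT; [|lra..].
  by rewrite scale1r mulr0 scale0r addr0.
- exact: ftilde_norm_le.
- move=> /LipOn_lt_pinftyP[L L0 [-> fL]].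
  have Rr0 : 0 <= R * r by rewrite mulr_ge0 //; lra.
  have f_lip x y : `|x - x0| < r -> `|y - x0| < r ->
      `|f x - f y| <= L * `|x - y| by move=> ? ?; apply: fL; rewrite ballE.
  have lip : (Lip (ftilde f R r x0) <= (L + R * r)%:E)%E.
    apply: Lip_le => [|x y]; first exact: addr_ge0.
    (* The bound is symmetric in [x] and [y], so the point nearer to [x0] may be taken first. *)
    have [xy|/ltW yx] := leP `|x - x0| `|y - x0|.
      exact: (ftilde_lip_ordered dotP).
    by rewrite distrC (distrC x); exact: (ftilde_lip_ordered dotP).
  by split; [exact: le_lt_trans lip (ltry _)|rewrite -EFinD].
- move=> x y; have [xy|/ltW yx] := leP `|x - x0| `|y - x0|.
    exact: (ftilde_mono_ordered dotP).
  rewrite -(opprB (_ y)) -(opprB y) linearNl linearNr opprK.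
  exact: (ftilde_mono_ordered dotP).
Qed.
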